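(* Let $K$ be a finite field, let $r\ge3$, and let $Q_r$ be the Kronecker quiver algebra of index $r$ over $K$. Then $Q_r$ is of non-amenable representation type; that is, the family of all finitely generated left $Q_r$-modules is not hyperfinite.
   Context: $Q_r$ is the finite dimensional $K$-algebra with basis $p_1,p_2,e_1,\dots,e_r$ and multiplication given by $p_1^2=p_1$, $p_2^2=p_2$, $p_1+p_2=1$, $p_1p_2=p_2p_1=0$, and for all $1\le i,j\le r$: $e_ip_1=e_i$, $p_1e_i=0$, $e_ip_2=0$, $p_2e_i=e_i$, $e_ie_j=0$. For a finite dimensional $K$-algebra $R$, a family $\mathcal F$ of finitely generated left $R$-modules is hyperfinite if for any $\epsilon>0$ there is a finite family $N_1,\dots,N_t$ of finitely generated $R$-modules such that for every $M\in\mathcal F$ there exist a submodule $P\subset M$ with $\dim_K(P)\ge(1-\epsilon)\dim_K(M)$ and non-negative integers $\alpha_1,\dots,\alpha_t$ with $P\cong\bigoplus_{i=1}^tN_i^{\alpha_i}$. An algebra $R$ with infinitely many isomorphism classes of finitely generated indecomposable modules is of amenable representation type if the family of all finitely generated $R$-modules is hyperfinite, and of non-amenable representation type otherwise. *)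

(* Defs.v *)
From HB Require Import structures.
From mathcomp Require Import all_boot all_order all_algebra all_field.
From mathcomp Require Import reals.

Set Implicit Arguments.
Unset Strict Implicit.
Unset Printing Implicit Defensive.

Import Order.TTheory GRing.Theory Num.Theory.
Local Open Scope ring_scope.

(* An element (a, b, v) stands for a p_1 + b p_2 + \sum_i v_i e_i. *)
Definition kronecker (K : fieldType) (r : nat) : Type :=
  (K^o * K^o * 'rV[K]_r)%type.

Section Kronecker.
Variables (K : fieldType) (r : nat).

HB.instance Definition _ := Vector.copy (kronecker K r) (K^o * K^o * 'rV[K]_r)%type.

Implicit Types x y z : kronecker K r.

Definition kron_p1 : kronecker K r := (1, 0, 0).
Definition kron_p2 : kronecker K r := (0, 1, 0).
Definition kron_e (i : 'I_r) : kronecker K r := (0, 0, delta_mx 0 i).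

(* The bilinear extension of the multiplication table: only the products
   e_i p_1 = e_i and p_2 e_i = e_i contribute to the last component. *)
Definition kron_one : kronecker K r := (1, 1, 0).
Definition kron_mul x y : kronecker K r :=
  (x.1.1 * y.1.1, x.1.2 * y.1.2, y.1.1 *: x.2 + x.1.2 *: y.2).

Fact kron_mulA : associative kron_mul.
Proof.
move=> x y z; rewrite /kron_mul /= !mulrA; congr (_, _, _).
by rewrite !scalerDr !scalerA addrA (mulrC z.1.1 y.1.1) (mulrC z.1.1 x.1.2)
  (mulrC y.1.1).
Qed.

Fact kron_mul1 : left_id kron_one kron_mul.
Proof.
by move=> [[a b] v]; rewrite /kron_mul /= !mul1r scaler0 add0r scale1r.
Qed.

Fact kron_mulr1 : right_id kron_one kron_mul.
Proof.
by move=> [[a b] v]; rewrite /kron_mul /= !mulr1 scaler0 addr0 scale1r.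
Qed.

Fact kron_mulDl : left_distributive kron_mul +%R.
Proof.
move=> x y z; rewrite /kron_mul /= !mulrDl; congr (_, _, _).
by rewrite /= scalerDr scalerDl addrACA.
Qed.

Fact kron_mulDr : right_distributive kron_mul +%R.
Proof.
move=> x y z; rewrite /kron_mul /= !mulrDr; congr (_, _, _).
by rewrite /= scalerDr scalerDl addrACA.
Qed.

Fact kron_one_neq0 : kron_one != 0.
Proof. by apply/eqP => -[/eqP]; rewrite oner_eq0. Qed.

HB.instance Definition _ := GRing.Zmodule_isNzRing.Build (kronecker K r)
  kron_mulA kron_mul1 kron_mulr1 kron_mulDl kron_mulDr kron_one_neq0.

Fact kron_scalerAl (a : K) x y : a *: (x * y) = (a *: x) * y.
Proof.
congr (_, _, _); rewrite /= ?scalerAl //.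
by rewrite scalerDr !scalerA (mulrC a).
Qed.

HB.instance Definition _ := GRing.Lmodule_isLalgebra.Build K (kronecker K r)
  kron_scalerAl.

Fact kron_scalerAr (a : K) x y : a *: (x * y) = x * (a *: y).
Proof.
congr (_, _, _); rewrite /= ?scalerAr //.
by rewrite scalerDr !scalerA (mulrC a x.1.2).
Qed.

HB.instance Definition _ := GRing.Lalgebra_isAlgebra.Build K (kronecker K r)
  kron_scalerAr.
HB.instance Definition _ := Algebra_isFalgebra.Build K (kronecker K r).

Lemma kron_table (i j : 'I_r) :
  [/\ kron_p1 * kron_p1 = kron_p1, kron_p2 * kron_p2 = kron_p2,
      kron_p1 + kron_p2 = 1, kron_p1 * kron_p2 = 0 & kron_p2 * kron_p1 = 0]
  /\ [/\ kron_e i * kron_p1 = kron_e i, kron_p1 * kron_e i = 0,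
         kron_e i * kron_p2 = 0, kron_p2 * kron_e i = kron_e i
       & kron_e i * kron_e j = 0].
Proof.
by split; split; congr (_, _, _);
  rewrite /= ?(mulr0, mul0r, mulr1, addr0, add0r, scale0r, scaler0, scale1r).
Qed.

Lemma kron_basis :
  basis_of {: kronecker K r} [:: kron_p1, kron_p2 & [seq kron_e i | i : 'I_r]].
Proof.
rewrite basisEdim; apply/andP; split; last first.
  rewrite dimvf /= size_map -cardE card_ord.
  have -> : dim (kronecker K r) = (1 + 1 + 1 * r)%N by [].
  by rewrite mul1n.
apply/subvP => -[[a b] v] _.
have -> : (a, b, v) = a *: kron_p1 + b *: kron_p2 + \sum_i v 0 i *: kron_e i
    :> kronecker K r.
  have -> : \sum_i v 0 i *: kron_e i = (0, 0, v).
    rewrite [v in RHS]row_sum_delta.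
    apply: (big_rec2 (fun (s : kronecker K r) w => s = (0, 0, w))) => //.
    by move=> i s w _ ->; congr (_, _, _); rewrite /= ?scaler0 ?addr0.
  by congr (_, _, _); rewrite /= ?scaler0 ?add0r ?addr0 // /GRing.scale /= mulr1.
apply: memvD; first apply: memvD.
- by apply: memvZ; apply: memv_span; rewrite inE eqxx.
- by apply: memvZ; apply: memv_span; rewrite !inE eqxx orbT.
apply: memv_suml => i _; apply: memvZ; apply: memv_span.
by rewrite !inE (map_f _ (mem_enum _ i)) !orbT.
Qed.

End Kronecker.

Section DirectSum.
Variables (A : pzRingType) (I : finType) (V : I -> lmodType A).

Definition dsum : Type := {dffun forall i : I, V i}.

HB.instance Definition _ := Choice.on dsum.

Implicit Types f g : dsum.

Definition dsum_zero : dsum := [ffun i => 0 : V i].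
Definition dsum_opp f : dsum := [ffun i => - f i : V i].
Definition dsum_add f g : dsum := [ffun i => f i + g i : V i].
Definition dsum_scale (a : A) f : dsum := [ffun i => a *: f i : V i].

Fact dsum_addA : associative dsum_add.
Proof. by move=> f g h; apply/ffunP => i; rewrite !ffunE addrA. Qed.
Fact dsum_addC : commutative dsum_add.
Proof. by move=> f g; apply/ffunP => i; rewrite !ffunE addrC. Qed.
Fact dsum_add0 : left_id dsum_zero dsum_add.
Proof. by move=> f; apply/ffunP => i; rewrite !ffunE add0r. Qed.
Fact dsum_addN : left_inverse dsum_zero dsum_opp dsum_add.
Proof. by move=> f; apply/ffunP => i; rewrite !ffunE addNr. Qed.

HB.instance Definition _ :=
  GRing.isZmodule.Build dsum dsum_addA dsum_addC dsum_add0 dsum_addN.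

Fact dsum_scaleA a b f : dsum_scale a (dsum_scale b f) = dsum_scale (a * b) f.
Proof. by apply/ffunP => i; rewrite !ffunE scalerA. Qed.
Fact dsum_scale1 : left_id 1 dsum_scale.
Proof. by move=> f; apply/ffunP => i; rewrite !ffunE scale1r. Qed.
Fact dsum_scaleDr : right_distributive dsum_scale +%R.
Proof. by move=> a f g; apply/ffunP => i; rewrite !ffunE scalerDr. Qed.
Fact dsum_scaleDl f : {morph dsum_scale^~ f : a b / a + b}.
Proof. by move=> a b; apply/ffunP => i; rewrite !ffunE scalerDl. Qed.

HB.instance Definition _ := GRing.Zmodule_isLmodule.Build A dsum
  dsum_scaleA dsum_scale1 dsum_scaleDr dsum_scaleDl.

End DirectSum.

Section Submodule.
Variables (A : pzRingType) (M : lmodType A) (P : submodClosed M).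

Definition submodule : Type := {x : M | x \in P}.

HB.instance Definition _ := SubChoice.on submodule.
HB.instance Definition _ := [SubChoice_isSubLmodule of submodule by <:].

End Submodule.

Section RestrictScalars.
Variables (K : fieldType) (A : algType K) (M : lmodType A).

(* M as a K-vector space, through the structure map a |-> a%:A of A. *)
Definition resK : Type := M.

HB.instance Definition _ := GRing.Zmodule.on resK.

Definition resK_scale (a : K) (x : resK) : resK := (a%:A : A) *: (x : M).

Fact resK_scaleA a b x : resK_scale a (resK_scale b x) = resK_scale (a * b) x.
Proof. by rewrite /resK_scale scalerA -scalerAl mul1r scalerA. Qed.
Fact resK_scale1 : left_id 1 resK_scale.
Proof. by move=> x; rewrite /resK_scale !scale1r. Qed.
Fact resK_scaleDr : right_distributive resK_scale +%R.
Proof. by move=> a x y; rewrite /resK_scale scalerDr. Qed.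
Fact resK_scaleDl x : {morph resK_scale^~ x : a b / a + b}.
Proof. by move=> a b; rewrite /resK_scale !scalerDl. Qed.

HB.instance Definition _ := GRing.Zmodule_isLmodule.Build K resK
  resK_scaleA resK_scale1 resK_scaleDr resK_scaleDl.

Definition has_dim (n : nat) : Prop := inhabited (Vector.axiom n resK).

End RestrictScalars.

Definition isomorphic (A : pzRingType) (U V : lmodType A) : Prop :=
  exists f : {linear U -> V}, bijective f.

Definition fin_gen (A : pzRingType) (M : lmodType A) : Prop :=
  exists (n : nat) (g : 'I_n -> M),
    forall x : M, exists c : 'I_n -> A, x = \sum_i c i *: g i.

Definition nonzero_module (A : pzRingType) (M : lmodType A) : Prop :=
  exists x : M, x != 0.

Definition indecomposable (A : pzRingType) (M : lmodType A) : Prop :=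
  nonzero_module M /\
  forall U V : lmodType A, nonzero_module U -> nonzero_module V ->
    ~ isomorphic M (U * V)%type.

(* \bigoplus_i N_i^(alpha_i): one summand for each pair (i, k), k < alpha_i. *)
Definition dsum_pow (A : pzRingType) (t : nat) (N : 'I_t -> lmodType A)
    (alpha : 'I_t -> nat) : lmodType A :=
  dsum (fun ik : {i : 'I_t & 'I_(alpha i)} => N (tag ik)).

Section RepresentationType.
Variables (R : realType) (K : fieldType) (A : falgType K).

Definition hyperfinite (F : lmodType A -> Prop) : Prop :=
  forall eps : R, 0 < eps ->
  exists (t : nat) (N : 'I_t -> lmodType A),
    (forall i, fin_gen (N i)) /\
    forall M : lmodType A, F M ->
    exists (P : submodClosed M) (alpha : 'I_t -> nat) (m p : nat),
      [/\ has_dim M m, has_dim (submodule P) p,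
          (1 - eps) * m%:R <= p%:R
        & isomorphic (submodule P) (dsum_pow N alpha)].

Definition infinite_representation_type : Prop :=
  ~ exists (t : nat) (N : 'I_t -> lmodType A),
      forall M : lmodType A, fin_gen M -> indecomposable M ->
      exists i, isomorphic M (N i).

Definition amenable_representation_type : Prop :=
  infinite_representation_type /\ hyperfinite (@fin_gen A).

Definition nonamenable_representation_type : Prop :=
  infinite_representation_type /\ ~ hyperfinite (@fin_gen A).

End RepresentationType.

(* Main.v *)
(* Non-hyperfiniteness is a counting argument.  There are q^(r n^2) tuples of r
   matrices of size n over K = F_q, each giving a representation of dimension 2n.
   If every one of them had a submodule of codimension at most 2n/(4r) isomorphic
   to a direct sum of copies of N_1, .., N_t, there would be at most q^(2nt)
   isomorphism types for the submodule; given the type, the tuple is determined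
   by its two components as embedded in K^n (q^(2n^2) choices at most) together
   with the r matrices on a complement (q^(n^2/2) choices at most).  As r >= 3,
   this is fewer than q^(r n^2) when n > 4t.
   For infinite type, the tuple (1, E_00, shift, ..) commutes only with scalars,
   so it gives an indecomposable representation of each even dimension. *)
Require Import Defs.
From HB Require Import structures.
From mathcomp Require Import all_boot all_order all_algebra all_field.
From mathcomp Require Import boolp reals.
From mathcomp Require Import zify.

Set Implicit Arguments.
Unset Strict Implicit.
Unset Printing Implicit Defensive.

Import Order.TTheory GRing.Theory Num.Theory.

(** * Modules over the Kronecker algebra from tuples of matrices *)

Section KroneckerModule.
Local Open Scope ring_scope.
Variables (K : finFieldType) (r n : nat).
Implicit Type A : {ffun 'I_r -> 'M[K]_n}.

(* The representation K^n => K^n in which e_j acts on row vectors by x |-> x A_j. *)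
Definition kron_rep A : Type := ('rV[K]_n * 'rV[K]_n)%type.

Variable A : {ffun 'I_r -> 'M[K]_n}.
HB.instance Definition _ := GRing.Zmodule.on (kron_rep A).
HB.instance Definition _ := Finite.on (kron_rep A).

Definition kron_act (a : kronecker K r) (x : kron_rep A) : kron_rep A :=
  (a.1.1 *: x.1, a.1.2 *: x.2 + \sum_j a.2 0 j *: (x.1 *m A j)).

Fact kron_actA a b x : kron_act a (kron_act b x) = kron_act (a * b) x.
Proof.
congr (_, _); rewrite /= ?scalerA // scalerDr scalerA -addrA; congr (_ + _).
rewrite scaler_sumr -big_split; apply: eq_bigr => j _ /=.
by rewrite !mxE scalerDl -scalemxAl !scalerA addrC (mulrC b.1.1).
Qed.
Fact kron_act1 : left_id 1 kron_act.
Proof.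
case=> x y; rewrite /kron_act /= !scale1r big1 ?addr0 // => j _.
by rewrite mxE scale0r.
Qed.
Fact kron_actDr : right_distributive kron_act +%R.
Proof.
move=> a x y; congr (_, _); rewrite /= ?scalerDr // addrACA; congr (_ + _).
by rewrite -big_split; apply: eq_bigr => j _; rewrite mulmxDl scalerDr.
Qed.
Fact kron_actDl x : {morph kron_act^~ x : a b / a + b}.
Proof.
move=> a b; congr (_, _); rewrite /= ?scalerDl // addrACA; congr (_ + _).
by rewrite -big_split; apply: eq_bigr => j _; rewrite mxE scalerDl.
Qed.

HB.instance Definition _ := GRing.Zmodule_isLmodule.Build (kronecker K r)
  (kron_rep A) kron_actA kron_act1 kron_actDr kron_actDl.

Lemma kron_repZ (a : kronecker K r) (x : kron_rep A) :
  a *: x = (a.1.1 *: x.1, a.1.2 *: x.2 + \sum_j a.2 0 j *: (x.1 *m A j)).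
Proof. by []. Qed.

Lemma kron_rep_p1 (x : kron_rep A) : kron_p1 K r *: x = (x.1, 0).
Proof.
rewrite kron_repZ /= scale1r scale0r add0r big1 // => j _.
by rewrite mxE scale0r.
Qed.

Lemma kron_rep_p2 (x : kron_rep A) : kron_p2 K r *: x = (0, x.2).
Proof.
rewrite kron_repZ /= scale1r scale0r big1 ?addr0 // => j _.
by rewrite mxE scale0r.
Qed.

Lemma kron_rep_e (j : 'I_r) (x : kron_rep A) :
  kron_e K j *: x = (0, x.1 *m A j).
Proof.
rewrite kron_repZ /= !scale0r add0r (bigD1 j) //= big1 ?addr0.
  by rewrite mxE !eqxx scale1r.
by move=> i ij; rewrite mxE eqxx (negPf ij) scale0r.
Qed.

Lemma kron_rep_scalar (c : K) (x : kron_rep A) :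
  c%:A *: x = (c *: x.1, c *: x.2) :> kron_rep A.
Proof.
rewrite kron_repZ /= big1 => [|j _]; last by rewrite !mxE mulr0 scale0r.
by rewrite addr0 /GRing.scale /= !mulr1.
Qed.

(** Over a finite field the module is a finite set, so all its elements together serve as
    generators. *)
Lemma kron_rep_fin_gen : fin_gen (kron_rep A).
Proof.
exists #|{: kron_rep A}|, enum_val => x.
exists (fun i => (i == enum_rank x)%:R).
rewrite (bigD1 (enum_rank x)) //= eqxx scale1r enum_rankK big1 ?addr0 //.
by move=> i /negPf ->; rewrite scale0r.
Qed.

Lemma card_kron_rep : #|{: kron_rep A}| = (#|K| ^ (2 * n))%N.
Proof. by rewrite card_prod !card_mx !mul1n -expnD mul2n addnn. Qed.

Lemma kron_rep_has_dim m : has_dim (kron_rep A) m -> m = (2 * n)%N.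
Proof.
case=> -[f _ /bij_eq_card]; rewrite card_kron_rep card_mx mul1n => /eqP.
by rewrite eqn_exp2l ?finNzRing_gt1 // => /eqP ->.
Qed.

End KroneckerModule.

(** * Isomorphisms and direct powers of modules *)

Section Modules.
Local Open Scope ring_scope.
Variable A : pzRingType.

Lemma isomorphic_sym (U V : lmodType A) : isomorphic U V -> isomorphic V U.
Proof.
case=> f [g fK gK].
have lin_g : linear g := GRing.can2_linear fK gK.
pose G : {linear V -> U} := HB.pack g (GRing.isLinear.Build A V U _ g lin_g).
by exists G; exists f.
Qed.

Lemma isomorphic_trans (U V W : lmodType A) :
  isomorphic U V -> isomorphic V W -> isomorphic U W.
Proof.
by case=> f bij_f [g bij_g]; exists (g \o f : {linear U -> W}); apply: bij_comp.
Qed.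

Section DirectPower.
Variables (t : nat) (N : 'I_t -> lmodType A).
Implicit Types alpha beta : 'I_t -> nat.

(* Drops the summands missing from beta and fills the new ones with 0. *)
Definition dsum_pow_conv alpha beta (f : dsum_pow N alpha) : dsum_pow N beta :=
  [ffun ik : {i & 'I_(beta i)} =>
    if insub (val (tagged ik)) is Some k then f (Tagged (fun i => 'I_(alpha i)) k)
    else 0 : N (tag ik)].

Lemma dsum_pow_conv_linear alpha beta : linear (@dsum_pow_conv alpha beta).
Proof.
move=> a f g; apply/ffunP => ik; rewrite !ffunE; case: insub => [k|].
  by rewrite !ffunE.
by rewrite scaler0 addr0.
Qed.

Lemma dsum_pow_convK alpha beta :
  (forall i, nonzero_module (N i) -> (alpha i <= beta i)%N) ->
  cancel (@dsum_pow_conv alpha beta) (@dsum_pow_conv beta alpha).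
Proof.
move=> le_ab f; apply/ffunP => -[i k]; rewrite ffunE /=.
case: insubP => /= [k' lt_k def_k'|lt_k].
  by rewrite ffunE /= def_k' valK.
apply/eqP; rewrite eq_sym; apply: contraNT lt_k => f_neq0.
apply: leq_trans (ltn_ord k) (le_ab i _).
by exists (f (Tagged (fun i => 'I_(alpha i)) k)).
Qed.

(** Copies of a zero module contribute nothing, so exponents only matter where [N i] is nonzero;
    elsewhere no cardinality bound could control them. *)
Lemma isomorphic_dsum_pow alpha beta :
  (forall i, nonzero_module (N i) -> alpha i = beta i) ->
  isomorphic (dsum_pow N alpha) (dsum_pow N beta).
Proof.
move=> eq_ab; pose f := @dsum_pow_conv alpha beta.
pose F : {linear dsum_pow N alpha -> dsum_pow N beta} :=
  HB.pack f (GRing.isLinear.Build A _ _ _ f (@dsum_pow_conv_linear alpha beta)).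
by exists F; exists (@dsum_pow_conv beta alpha); apply: dsum_pow_convK => i /eq_ab->.
Qed.

(** A nonzero [x] in [N i] yields [alpha i + 1] distinct elements of the sum: zero, and [x] placed
    in each single copy of [N i]. *)
Lemma dsum_pow_exponent_lt alpha (T : finType) (g : dsum_pow N alpha -> T) i :
  injective g -> nonzero_module (N i) -> (alpha i < #|T|)%N.
Proof.
move=> inj_g [x x_neq0].
pose d0 (o : option 'I_(alpha i)) (jk : {j & 'I_(alpha j)}) : N (tag jk) :=
  if o is Some k then
    if tag jk =P i is ReflectT e then
      if val (tagged jk) == val k then ecast j (N j) (esym e) x else 0
    else 0
  else 0.
pose d o : dsum_pow N alpha := [ffun jk => d0 o jk].
have d_Some k : d (Some k) (Tagged (fun j => 'I_(alpha j)) k) = x.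
  rewrite ffunE /d0 /=; case: eqP => [e|//].
  by rewrite (eq_irrelevance e erefl) eqxx.
suff inj_d : injective d.
  by move: (leq_card _ (inj_comp inj_g inj_d)); rewrite card_option card_ord.
have d_eq k o : d (Some k) = d o -> Some k = o.
  move=> eq_d; move: (d_Some k); rewrite eq_d ffunE /d0 /=.
  case: o {eq_d} => [l|/esym/eqP]; last by rewrite (negPf x_neq0).
  case: eqP => [e|//]; case: eqP => [/val_inj-> //|_ /esym/eqP].
  by rewrite (negPf x_neq0).
case=> [k|] [l|] // eq_d; first exact: d_eq.
  exact: d_eq.
by rewrite -(d_eq l None).
Qed.

End DirectPower.
End Modules.

(** * Counting matrix tuples over a finite field *)

Section Counting.
Local Open Scope ring_scope.
Variable K : finFieldType.

(** Each [A j] is prescribed on the row space of [Z], so it is determined by its values on a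
    complement, of dimension [n - \rank Z]. *)
Lemma card_mulmx_fiber (r p n : nat) (Z : 'M[K]_(p, n))
    (B : {ffun 'I_r -> 'M[K]_(p, n)}) :
  (#|[set A : {ffun 'I_r -> 'M[K]_n} | [forall j, Z *m A j == B j]]|
     <= #|K| ^ ((n - \rank Z) * n * r))%N.
Proof.
pose C := row_base (Z^C)%MS.
have -> : (#|K| ^ ((n - \rank Z) * n * r) =
           #|{ffun 'I_r -> 'M[K]_(\rank Z^C, n)}|)%N.
  by rewrite card_ffun card_mx card_ord mxrank_compl -expnM.
apply: (leq_card_in (fun A : {ffun _ -> _} => [ffun j => C *m A j])).
move=> A1 A2; rewrite !inE => /forallP ZA1 /forallP ZA2 /ffunP eqCA.
apply/ffunP => j; have := eqCA j; rewrite !ffunE => CA.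
have full : row_full (col_mx Z C).
  rewrite -sub1mx -addsmxE (adds_eqmx (eqmx_refl Z) (eq_row_base _)) sub1mx.
  exact: addsmx_compl_full.
apply: (row_full_inj full).
by rewrite !mul_col_mx CA (eqP (ZA1 j)) (eqP (ZA2 j)).
Qed.

Lemma leq_card_cover_by (T C : finType) (S : {set T}) (F : C -> {set T}) m :
  (forall x, x \in S -> exists c, x \in F c) -> (forall c, #|F c| <= m)%N ->
  (#|S| <= #|C| * m)%N.
Proof.
move=> S_F F_m; apply: (@leq_trans #|\bigcup_c F c|).
  by apply/subset_leq_card/subsetP => x /S_F[c Fc]; apply/bigcupP; exists c.
rewrite -sum_nat_const.
apply: (big_ind2 (fun (X : {set T}) k => #|X| <= k)%N) => // [|X k Y l Xk Yl].
  by rewrite cards0.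
exact: leq_trans (leq_card_setU X Y) (leq_add Xk Yl).
Qed.

(** Union bound over the pairs [(G, H)]: each pair fixes the tuple outside a complement of dimension
    at most [d]. *)
Lemma card_intertwined (r p n d : nat) (Z : 'M[K]_(p, n))
    (B : {ffun 'I_r -> 'M[K]_(p, n)}) (S : {set {ffun 'I_r -> 'M[K]_n}}) :
  (forall A, A \in S -> exists G H : 'M[K]_n,
     (n - \rank (Z *m G) <= d)%N /\ forall j, Z *m G *m A j = B j *m H) ->
  (#|S| <= #|K| ^ (2 * n * n + d * n * r))%N.
Proof.
move=> S_GH.
pose F (GH : 'M[K]_n * 'M[K]_n) : {set {ffun 'I_r -> 'M[K]_n}} :=
  [set A : {ffun _ -> _} | (n - \rank (Z *m GH.1) <= d)%N
             && [forall j, Z *m GH.1 *m A j == B j *m GH.2]].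
have -> : (#|K| ^ (2 * n * n + d * n * r) =
           #|{: 'M[K]_n * 'M[K]_n}| * #|K| ^ (d * n * r))%N.
  by rewrite card_prod card_mx -!expnD -mulnA mul2n addnn.
apply: (leq_card_cover_by (F := F)) => [A /S_GH[G [H [rkG eqGH]]]|GH].
  exists (G, H); rewrite inE rkG.
  by apply/forallP => j; rewrite eqGH.
case: (leqP (n - \rank (Z *m GH.1))%N d) => [le_d|gt_d].
  pose B' := [ffun j => B j *m GH.2].
  apply: leq_trans (_ : #|K| ^ ((n - \rank (Z *m GH.1)) * n * r) <= _)%N.
    apply: leq_trans (card_mulmx_fiber (Z *m GH.1) B').
    apply/subset_leq_card/subsetP => A; rewrite !inE => /andP[_ /forallP ZA].
    by apply/forallP => j; rewrite ffunE.
  by rewrite leq_exp2l ?finNzRing_gt1 // !leq_mul2r le_d !orbT.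
rewrite (_ : F GH = set0) ?cards0 //; apply/setP => A.
by rewrite !inE leqNgt gt_d.
Qed.

End Counting.

(** * Comparing isomorphic submodules of two representations *)

Section Comparison.
Local Open Scope ring_scope.
Variable K : finFieldType.

Lemma linear_rV_matrix (p n : nat) (f : 'rV[K]_p -> 'rV[K]_n) :
  linear f -> exists Z, forall u, u *m Z = f u.
Proof.
move=> lin_f.
pose F : {linear 'rV_p -> 'rV_n} := HB.pack f (GRing.isLinear.Build K _ _ _ f lin_f).
by exists (lin1_mx F) => u; rewrite mul_rV_lin1.
Qed.

Lemma mulmx_factor (p m n : nat) (Z : 'M[K]_(p, m)) (W : 'M[K]_(p, n)) :
  (forall u : 'rV_p, u *m Z = 0 -> u *m W = 0) -> exists G, W = Z *m G.
Proof.
move=> kerZW; exists (pinvmx Z *m W); apply/eqP; rewrite -subr_eq0; apply/eqP.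
rewrite mulmxA -{1}[W]mul1mx -mulmxBl; apply/row_matrixP => i.
rewrite row_mul row0; apply: kerZW.
by rewrite -row_mul mulmxBl mul1mx mulmxKpV // subrr row0.
Qed.

(** [Y] is injective on the left kernel of [Z], which has dimension [p - \rank Z]. *)
Lemma leq_rank_jointly_free (p m n : nat) (Z : 'M[K]_(p, m)) (Y : 'M[K]_(p, n)) :
  (forall u : 'rV_p, u *m Z = 0 -> u *m Y = 0 -> u = 0) ->
  (p <= \rank Z + n)%N.
Proof.
move=> freeZY; rewrite -leq_subLR -mxrank_ker.
apply: leq_trans (rank_leq_col (kermx Z *m Y)).
suff /eqP cap0 : (kermx Z :&: kermx Y)%MS == 0.
  by rewrite -(mxrank_mul_ker (kermx Z) Y) cap0 mxrank0 addn0.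
apply/rowV0P => u; rewrite sub_capmx => /andP[/sub_kermxP uZ /sub_kermxP uY].
exact: freeZY.
Qed.

Lemma has_dim_param (A : algType K) (M : lmodType A) p : has_dim M p ->
  exists th : 'rV[K]_p -> M,
    bijective th /\ forall a u v, th (a *: u + v) = a%:A *: th u + th v.
Proof.
case=> -[f lin_f [g fK gK]]; exists g; split; first by exists f.
move=> a u v; apply: (can_inj fK); rewrite gK.
by have := lin_f a (g u) (g v); rewrite !gK => <-.
Qed.

Variables (r n : nat).
Implicit Types A : {ffun 'I_r -> 'M[K]_n}.

Lemma kron_rep_param A p (th : 'rV[K]_p -> kron_rep A) :
  (forall a u v, th (a *: u + v) = a%:A *: th u + th v) ->
  exists Z Y, forall u, th u = (u *m Z, u *m Y).
Proof.
move=> lin_th.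
have [|Z defZ] := @linear_rV_matrix p n (fun u => (th u).1).
  by move=> a u v; rewrite lin_th kron_rep_scalar.
have [|Y defY] := @linear_rV_matrix p n (fun u => (th u).2).
  by move=> a u v; rewrite lin_th kron_rep_scalar.
by exists Z, Y => u; rewrite defZ defY -surjective_pairing.
Qed.

(* Z is the component p_1 P0 -> K^n of the inclusion of P0, written in a basis of
   P0; G and H extend the two components of the isomorphism P0 -> P to K^n. *)
Lemma isomorphic_submodules_intertwined A0 (P0 : submodClosed (kron_rep A0)) p :
  has_dim (submodule P0) p ->
  exists Z : 'M[K]_(p, n), forall A (P : submodClosed (kron_rep A)),
    isomorphic (submodule P0) (submodule P) ->
    exists G H : 'M[K]_n, (p <= \rank (Z *m G) + n)%N /\
      forall j, Z *m G *m A j = Z *m A0 j *m H.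
Proof.
case/has_dim_param => th [[th' thK th'K] lin_th].
have [|Z0 [Y0 def_th]] := @kron_rep_param A0 p (val \o th).
  by move=> a u v; rewrite /= lin_th.
exists Z0 => A P [psi /bij_inj inj_psi].
have [|Z [Y def_psi]] := @kron_rep_param A p (fun u => val (psi (th u))).
  by move=> a u v; rewrite lin_th linearP.
have psi0 a u : a *: th u = 0 -> a *: psi (th u) = 0.
  by move=> au0; rewrite -linearZ au0 linear0.
(* If [u *m Z0 = 0] then [p_1] kills [th u], hence also [psi (th u)], so [u *m Z = 0]. The same
   argument with [p_2] gives [H]. *)
have [u uZ0|G defZ] := @mulmx_factor p n n Z0 Z.
  have /psi0/(congr1 val) : kron_p1 K r *: th u = 0.
    by apply: val_inj; rewrite /= kron_rep_p1 [val _]def_th uZ0.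
  by rewrite /= kron_rep_p1 def_psi => -[].
have [u uY0|H defY] := @mulmx_factor p n n Y0 Y.
  have /psi0/(congr1 val) : kron_p2 K r *: th u = 0.
    by apply: val_inj; rewrite /= kron_rep_p2 [val _]def_th uY0.
  by rewrite /= kron_rep_p2 def_psi => -[].
exists G, H; rewrite -defZ; split=> [|j].
  apply: (leq_rank_jointly_free (Y := Y)) => u uZ uY.
  apply: (can_inj thK); apply: inj_psi; apply: val_inj.
  by rewrite !def_psi uZ uY !mul0mx.
apply/row_matrixP => i; rewrite !rowE !mulmxA.
(* [v] holds the coordinates of [e_j] applied to [th u]; comparing second components before and
   after [psi] gives the relation. *)
set u := delta_mx 0 i; pose v := th' (kron_e K j *: th u).
have def_v : th v = kron_e K j *: th u by rewrite th'K.
have := congr1 val def_v; rewrite /= [val _]def_th kron_rep_e [val _]def_th.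
case=> _ vY0; have := def_psi v; rewrite def_v linearZ /= kron_rep_e def_psi.
by case=> _ ->; rewrite defY mulmxA vY0.
Qed.

End Comparison.

(** * Failure of hyperfiniteness *)

Section Nonhyperfinite.
Variables (R : realType) (K : finFieldType) (r : nat).
Hypothesis r_ge3 : (3 <= r)%N.

Lemma kronecker_not_hyperfinite : ~ hyperfinite R (@fin_gen (kronecker K r)).
Proof.
have r_gt0 : (0 < r)%N by apply: leq_trans r_ge3.
have eps_gt0 : (0 < ((4 * r)%:R^-1 : R))%R.
  by rewrite invr_gt0 ltr0n muln_gt0.
move=> /(_ _ eps_gt0)[t [N [_ hypN]]].
(* The choice [eps = 1 / (4r)] makes the codimension at most [d], with [2dr <= n]. Together with
   [4t < n] this gives [2t + dr < n]. *)
pose n := (4 * t).+1; pose d := (n %/ (2 * r))%N.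
pose T := {ffun 'I_r -> 'M[K]_n}.
pose q := #|K|; have q_gt1 : (1 < q)%N by apply: finNzRing_gt1.
(* [Q] is the number of elements of each representation, which exceeds every exponent of a nonzero
   [N i]. *)
pose Q := (q ^ (2 * n))%N.
pose C := {ffun 'I_t -> 'I_Q}.
pose inC (A : T) (c : C) : Prop :=
  exists (P : submodClosed (kron_rep A)) (p : nat),
    [/\ has_dim (submodule P) p, (2 * n <= p + d)%N
      & isomorphic (submodule P) (dsum_pow N (fun i => c i))].
have exC A : exists c, inC A c.
  have [P [alpha [m [p [dimM dimP le_p isoP]]]]] :=
    hypN (kron_rep A) (kron_rep_fin_gen A).
  have Q_gt0 : (0 < Q)%N by rewrite expn_gt0 ltnW.
  have lt_alpha i : nonzero_module (N i) -> (alpha i < Q)%N.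
    have [f /bij_inj inj_f] := isomorphic_sym isoP.
    rewrite /Q /q -(card_kron_rep A); apply: (dsum_pow_exponent_lt (g := val \o f)).
    exact: inj_comp val_inj inj_f.
  (* The default 0 is taken only when [alpha i >= Q], which forces [N i] to be zero. *)
  pose c : C := [ffun i => insubd (Ordinal Q_gt0) (alpha i)].
  exists c, P, p; split=> //.
    move: le_p; rewrite (kron_rep_has_dim dimM).
    have r4_gt0 : (0 < (4 * r)%:R :> R)%R by rewrite ltr0n muln_gt0.
    rewrite -(ler_pM2r r4_gt0) mulrAC mulrBl mul1r mulVf ?gt_eqF // mulrBl mul1r.
    rewrite lerBlDr -!natrM -natrD ler_nat => le_p.
    rewrite -leq_subLR leq_divRL ?muln_gt0 //.
    rewrite mulnBl leq_subLR; nia.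
  apply: isomorphic_trans isoP (isomorphic_dsum_pow _) => i /lt_alpha lt_i.
  by rewrite ffunE insubdK.
have : (#|[set: T]| <= #|C| * q ^ (2 * n * n + d * n * r))%N.
  apply: (leq_card_cover_by (F := fun c => [set A | `[< inC A c >]])).
    by move=> A _; have [c Ac] := exC A; exists c; rewrite inE; apply/asboolP.
  (* One member [A0] of the class serves as reference: the same [Z] and [Z *m A0 j] then constrain
     every other member. *)
  move=> c; have [->|/set0Pn[A0]] := eqVneq [set A | `[< inC A c >]] set0.
    by rewrite cards0.
  rewrite inE => /asboolP[P0 [p [dimP0 le_p isoP0]]].
  have [Z Zprop] := isomorphic_submodules_intertwined dimP0.
  apply: (card_intertwined (Z := Z) (B := [ffun j => Z *m A0 j]%R)) => A.
  rewrite inE => /asboolP[P [_ [_ _ isoP]]].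
  have [G [H [le_rk eqGH]]] :=
    Zprop A P (isomorphic_trans isoP0 (isomorphic_sym isoP)).
  exists G, H; split=> [|j]; last by rewrite ffunE.
  rewrite leq_subLR; move: (leq_trans le_p (leq_add le_rk (leqnn d))).
  by rewrite mul2n -addnn -addnA (addnC n d) addnA leq_add2r.
rewrite cardsT !card_ffun card_mx !card_ord -!expnM -expnD leq_exp2l //.
(* After cancelling [n], the bound reads [n * r <= 2t + 2n + dr], whose right side is less than
   [3n]. *)
have le_dr : (2 * (d * r) <= n)%N by rewrite mulnCA leq_trunc_div.
have le_3n : (n * 3 <= n * r)%N by rewrite leq_mul2l r_ge3 orbT.
have -> : (2 * n * t + (2 * n * n + d * n * r) = n * (2 * t + 2 * n + d * r))%N.
  by lia.
by rewrite -mulnA leq_pmul2l // leqNgt => /negP[]; rewrite /n in le_dr le_3n *; lia.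
Qed.

End Nonhyperfinite.

(** * Infinitely many indecomposables *)

Section InfiniteType.
Local Open Scope ring_scope.
Variable K : finFieldType.

(** Commuting with [delta_mx 0 0] makes the first basis row an eigenvector of [G]; the shift sends
    each basis row to the next and so propagates the eigenvalue. *)
Lemma commute_delta_shift_scalar n (G : 'M[K]_n.+1) :
  let S : 'M[K]_n.+1 := \matrix_(i, j) (j == i.+1 :> nat)%:R in
  delta_mx 0 0 *m G = G *m delta_mx 0 0 -> S *m G = G *m S ->
  exists c, G = c%:M.
Proof.
move=> S GE GS; exists (G 0 0); apply/row_matrixP => -[i lt_i].
rewrite !rowE mul_mx_scalar; elim: i lt_i => [|i IHi] lt_i.
  have -> : Ordinal lt_i = 0 by apply: val_inj.
  rewrite -{1}[delta_mx 0 0](mul_delta_mx (0 : 'I_n.+1)) -mulmxA GE mulmxA.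
  apply/rowP => j; rewrite -rowE !mxE (bigD1 0) //= big1 ?addr0 => [|k k0].
    by rewrite !mxE eqxx.
  by rewrite !mxE (negPf k0) mulr0.
have lt_i' := ltnW lt_i.
have -> : delta_mx 0 (Ordinal lt_i) = delta_mx 0 (Ordinal lt_i') *m S :> 'rV_n.+1.
  by apply/rowP => j; rewrite -rowE !mxE.
by rewrite -mulmxA GS mulmxA IHi -scalemxAl.
Qed.

Variables (r n : nat) (A : {ffun 'I_r -> 'M[K]_n.+1}) (j0 j1 j2 : 'I_r).
Hypothesis A0 : A j0 = 1%:M.
Hypothesis A1 : A j1 = delta_mx 0 0.
Hypothesis A2 : A j2 = \matrix_(i, j) (j == i.+1 :> nat)%:R.

(** An endomorphism commutes with [p_1], so it acts on the first component by some [G]. As [A j0] is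
    the identity, the second component also carries [G], which therefore commutes with every
    [A j]. *)
Lemma kron_rep_brick (phi : {linear kron_rep A -> kron_rep A}) :
  exists c : K, forall x, phi x = (c%:A : kronecker K r) *: x.
Proof.
have [|G defG] := @linear_rV_matrix K n.+1 n.+1
    (fun u => (phi ((u, 0) : kron_rep A)).1).
  move=> a u v.
  have -> : (a *: u + v, 0) = a%:A *: ((u, 0) : kron_rep A) + (v, 0) :> kron_rep A.
    by rewrite kron_rep_scalar scaler0; congr (_, _); rewrite addr0.
  by rewrite linearP kron_rep_scalar.
have phi1 u : phi ((u, 0) : kron_rep A) = (u *m G, 0).
  by rewrite defG -kron_rep_p1 -linearZ kron_rep_p1.
have phi_e j u : phi ((0, u *m A j) : kron_rep A) = (0, u *m G *m A j).
  have -> : (0, u *m A j) = kron_e K j *: ((u, 0) : kron_rep A).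
    by rewrite kron_rep_e.
  by rewrite linearZ phi1 /= kron_rep_e.
have phi2 u : phi ((0, u) : kron_rep A) = (0, u *m G).
  by have := phi_e j0 u; rewrite A0 !mulmx1.
have comm j : A j *m G = G *m A j.
  apply/row_matrixP => i; rewrite !rowE !mulmxA.
  by have := phi2 (delta_mx 0 i *m A j); rewrite phi_e => -[].
have [||c defc] := @commute_delta_shift_scalar n G; rewrite -?A1 -?A2 //.
exists c => -[u v]; rewrite kron_rep_scalar.
have -> : (u, v) = ((u, 0) : kron_rep A) + (0, v).
  by congr (_, _); rewrite ?addr0 ?add0r.
rewrite linearD phi1 phi2 defc !mul_mx_scalar.
by congr (_, _); rewrite /= ?addr0 ?add0r.
Qed.

Lemma kron_rep_indecomposable : indecomposable (kron_rep A).
Proof.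
split; first by exists (const_mx 1, 0); apply/eqP => -[/matrixP/(_ 0 0)/eqP];
  rewrite !mxE oner_eq0.
move=> U V [u u_neq0] [v v_neq0] [f [g fK gK]].
(* The projection onto [U] is an endomorphism, hence a scalar [c]; it fixes [U], excluding [c = 0],
   and kills [V], excluding [c != 0]. *)
pose pi x := g ((f x).1, 0).
have lin_pi : linear pi.
  move=> a x y; apply: (can_inj fK); rewrite /pi !linearP /= !gK.
  by congr (_, _); rewrite /= scaler0 addr0.
have [c def_pi] := kron_rep_brick
  (HB.pack_for {linear kron_rep A -> kron_rep A} pi
     (GRing.isLinear.Build _ _ _ _ pi lin_pi)).
have [c0|c_neq0] := eqVneq c 0.
  have := congr1 f (def_pi (g (u, 0))).
  rewrite /= /pi !gK /= c0 !scale0r linear0 => -[u0].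
  by rewrite u0 eqxx in u_neq0.
have := congr1 f (def_pi (g (0, v))); rewrite /= /pi linearZ !gK /= => -[_ cv0].
have := congr1 (GRing.scale ((c^-1)%:A : kronecker K r)) cv0.
rewrite scaler0 scalerA -scalerAl mul1r scalerA mulVf // !scale1r => v0.
by rewrite -v0 eqxx in v_neq0.
Qed.

End InfiniteType.

Lemma kronecker_infinite_type (K : finFieldType) (r : nat) :
  (3 <= r)%N -> infinite_representation_type (kronecker K r).
Proof.
move=> r_ge3 [t [N hypN]].
pose A n : {ffun 'I_r -> 'M[K]_n.+1} :=
  [ffun j : 'I_r => if j == 0%N :> nat then 1%:M
             else if j == 1%N :> nat then delta_mx 0 0
             else \matrix_(i, k) (k == i.+1 :> nat)%:R]%R.
have indecA n : indecomposable (kron_rep (A n)).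
  pose o k lt_k := Ordinal (leq_trans (lt_k : (k < 3)%N) r_ge3).
  apply: (@kron_rep_indecomposable _ _ _ _ (o 0%N isT) (o 1%N isT) (o 2%N isT));
    by rewrite ffunE.
(* Pigeonhole: [t + 1] indecomposables of distinct cardinalities cannot be matched with [t]
   isomorphism types. *)
have [s isoA] := fin_all_exists
  (fun k : 'I_t.+1 => hypN _ (kron_rep_fin_gen (A k)) (indecA k)).
suff /leq_card : injective s by rewrite !card_ord ltnn.
move=> k l eq_s; apply: val_inj.
have := isoA l; rewrite -eq_s => /isomorphic_sym/(isomorphic_trans (isoA k)).
case=> f /bij_eq_card/eqP; rewrite !card_kron_rep eqn_exp2l ?finNzRing_gt1 //.
by rewrite eqn_pmul2l // eqSS => /eqP.
Qed.

Theorem theorem6 (R : realType) (K : finFieldType) (r : nat) (hr : 3 <= r) :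
  nonamenable_representation_type R (kronecker K r).
Proof.
split; first exact: kronecker_infinite_type.
exact: kronecker_not_hyperfinite.
Qed.
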